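(* Let $\varphi$ be a crystalline anisotropy on $\mathbb{R}^2$, let $\alpha>0$, let $\Gamma^0=\bigcup_{i=1}^nS_i^0$ be a closed admissible stationary polygonal curve with angles $\theta_i$, and let $$\Delta_1:=\frac12\min_{1\le i\le n}\frac{\mathcal{H}^1(S_i^0)}{\frac1{|\sin\theta_i|}+|\cot\theta_i+\cot\theta_{i+1}|+\frac1{|\sin\theta_{i+1}|}}.$$ Then there exist constants $C,\beta>0$ such that, for every admissible polygonal curve $\Gamma=\bigcup_{i=1}^nS_i$ parallel to $\Gamma^0$ with $\max_{1\le i\le n}|H(S_i^0,S_i)|<\Delta_1$, one has $$|\mathcal{F}_\alpha(\Gamma)-\mathcal{F}_\alpha(\Gamma^0)|^\beta\le C\Big(\alpha\max_{1\le i\le n}c_i^2\delta_i\mathcal{H}^1(S_i)\Big)^\beta\sum_{i=1}^n\Big|c_i\mathcal{H}^1(F_i)+\alpha\Big(\frac{c_{i-1}^2\delta_{i-1}}{\mathcal{H}^1(S_{i-1})^2\sin\theta_i}+\frac{c_i^2\delta_i[\cot\theta_i+\cot\theta_{i+1}]}{\mathcal{H}^1(S_i)^2}+\frac{c_{i+1}^2\delta_{i+1}}{\mathcal{H}^1(S_{i+1})^2\sin\theta_{i+1}}\Big)\Big|.$$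
   Context: Anisotropy. An anisotropy is a convex, positively one-homogeneous function $\varphi:\mathbb{R}^2\to[0,\infty)$ with $c|x|\le\varphi(x)\le C|x|$ for some $0<c\le C<\infty$; $W^\varphi=\{\varphi\le1\}$ and $\varphi^o(x)=\max_{y\in W^\varphi}\langle x,y\rangle$. It is crystalline if $W^\varphi$ is a polygon, whose edges are called facets; $\nu_F$ is the outward unit normal of the facet $F$. $\mathcal{H}^1$ is length. Polygonal curves. All curves are oriented and may self-intersect. A closed polygonal curve is a closed consecutive union $\Gamma=\bigcup_{i=1}^nS_i$ of finitely many segments of positive length, indices being cyclic ($S_0=S_n$, $S_{n+1}=S_1$, likewise for all indexed quantities); consecutive segments are not parallel. $\nu_{S_i}$ is the unit tangent (in the direction of the parametrization) rotated counterclockwise by $90^\circ$. The angle $\theta_i$ between $S_{i-1}$ and $S_i$ is taken in $(0,\pi)$ if $S_{i-1},S_i$ form a convex cone for which $\nu_{S_{i-1}},\nu_{S_i}$ are inner normals, and in $(\pi,2\pi)$ otherwise (for a convex polygon with outward normals, $\theta_i$ is $2\pi$ minus the interior angle). Admissibility. $\Gamma$ is admissible if (for a suitable orientation) each $\nu_{S_i}$ equals $\nu_{F_i}$ for a (unique) facet $F_i$ of $W^\varphi$, and for consecutive $S_{i-1},S_i$ the facets $F_{i-1},F_i$ have a common vertex. The transition number $c_i$ of $S_i$ is $+1$ if $\theta_i,\theta_{i+1}\in(\pi,2\pi)$, $-1$ if $\theta_i,\theta_{i+1}\in(0,\pi)$, and $0$ otherwise. The $\varphi$-curvature on $S_i$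 is $\kappa_{S_i}^\varphi=c_i\mathcal{H}^1(F_i)/\mathcal{H}^1(S_i)$. Set $\delta_j=\mathcal{H}^1(F_j)^2\varphi^o(\nu_{S_j})$. Energy. $\mathcal{F}_\alpha(\Gamma)=\sum_{i=1}^n\varphi^o(\nu_{S_i})\big(\mathcal{H}^1(S_i)+\alpha c_i^2\mathcal{H}^1(F_i)^2/\mathcal{H}^1(S_i)\big)$, i.e. $\int_\Gamma(1+\alpha(\kappa_\Gamma^\varphi)^2)\varphi^o(\nu_\Gamma)\,d\mathcal{H}^1$. Parallel curves. $\bar\Gamma=\bigcup_{i=1}^n\bar S_i$ is parallel to $\Gamma=\bigcup_{i=1}^nS_i$ if each $\bar S_i$ is a nondegenerate segment parallel to $S_i$ with $\nu_{\bar S_i}=\nu_{S_i}$; then angles, facets $F_i$ and $c_i$ are the same. For parallel segments $S,T$ on lines $\ell_S,\ell_T$, $H(S,T)$ is the vector orthogonal to them with $\ell_T=\ell_S+H(S,T)$. Stationary. An admissible polygonal curve $\Gamma=\bigcup_iS_i$ is stationary if for every segment $S_i$ $$c_i\mathcal{H}^1(F_i)+\alpha\Big(\frac{c_{i-1}^2\delta_{i-1}}{\mathcal{H}^1(S_{i-1})^2\sin\theta_i}+\frac{c_i^2\delta_i[\cot\theta_i+\cot\theta_{i+1}]}{\mathcal{H}^1(S_i)^2}+\frac{c_{i+1}^2\delta_{i+1}}{\mathcal{H}^1(S_{i+1})^2\sin\theta_{i+1}}\Big)=0.$$ *)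

(* Defs.v *)
From HB Require Import structures.
From mathcomp Require Import all_boot all_order all_algebra.
From mathcomp Require Import all_classical all_reals all_analysis.

Set Implicit Arguments.
Unset Strict Implicit.
Unset Printing Implicit Defensive.

Import Order.TTheory GRing.Theory Num.Theory.

Local Open Scope classical_set_scope.
Local Open Scope ring_scope.

Section Plane.
Variable R : realType.

Definition plane := 'rV[R]_2.

Definition dot (u v : plane) : R := \sum_(k < 2) u 0 k * v 0 k.

(* The library norm on row vectors is the sup norm, hence this one. *)
Definition enorm (u : plane) : R := Num.sqrt (dot u u).

Definition det2 (u v : plane) : R := u 0 0 * v 0 1 - u 0 1 * v 0 0.

Definition unit_vec (u : plane) : plane := (enorm u)^-1 *: u.

(* Counterclockwise rotation by 90 degrees: (x, y) |-> (- y, x). *)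
Definition rot90 (u : plane) : plane :=
  \row_(k < 2) (if k == 0 then - u 0 1 else u 0 0).

Definition cot (x : R) : R := cos x / sin x.

(* A segment is the pair of its endpoints; it is oriented from the first one
   to the second one whenever orientation matters. *)
Definition segment : Type := (plane * plane)%type.

Definition dir (S : segment) : plane := S.2 - S.1.

(* One-dimensional Hausdorff measure of a segment. *)
Definition seg_length (S : segment) : R := enorm (dir S).

Definition seg_set (S : segment) : set plane :=
  [set x | exists2 t : R, 0 <= t <= 1 & x = S.1 + t *: dir S].

Definition seg_line (S : segment) : set plane :=
  [set x | exists t : R, x = S.1 + t *: dir S].

Definition seg_parallel (S T : segment) : Prop := det2 (dir S) (dir T) = 0.

Definition seg_normal (S : segment) : plane := rot90 (unit_vec (dir S)).

(* v is the vector H(S, T). *)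
Definition is_offset (S T : segment) (v : plane) : Prop :=
  dot v (dir S) = 0 /\ seg_line T = [set x + v | x in seg_line S].

Definition anisotropy (phi : plane -> R) : Prop :=
  [/\ forall x, 0 <= phi x,
      convex_function setT phi,
      forall (t : R) x, 0 < t -> phi (t *: x) = t * phi x &
      exists c C : R, [/\ 0 < c, c <= C &
        forall x, c * enorm x <= phi x <= C * enorm x]].

Definition wulff (phi : plane -> R) : set plane := [set x | phi x <= 1].

Definition dual_norm (phi : plane -> R) (x : plane) : R :=
  sup [set dot x y | y in wulff phi].

(* Convex hull of finitely many points. Degenerate hulls are not excluded here;
   the sets [wulff phi] contain a neighbourhood of the origin. *)
Definition polygon (W : set plane) : Prop :=
  exists V : set plane,
    finite_set V /\ W = smallest (@convex_set R plane) V.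

Definition crystalline (phi : plane -> R) : Prop :=
  anisotropy phi /\ polygon (wulff phi).

(* F is an edge of the convex set W with outward unit normal nu; the order of
   the endpoints of F is irrelevant. *)
Definition is_facet (W : set plane) (F : segment) (nu : plane) : Prop :=
  [/\ F.1 != F.2, enorm nu = 1 &
      seg_set F = [set x | W x /\ forall y, W y -> dot y nu <= dot x nu]].

Definition common_vertex (F G : segment) : Prop :=
  [\/ F.1 = G.1, F.1 = G.2, F.2 = G.1 | F.2 = G.2].

End Plane.

Section FiniteExtrema.
Variables (R : realType) (n : nat).

Definition max_ord (f : 'I_n.+1 -> R) : R := \big[Num.max/f ord0]_i f i.
Definition min_ord (f : 'I_n.+1 -> R) : R := \big[Num.min/f ord0]_i f i.

End FiniteExtrema.

(* A closed curve with n.+1 segments is given by its vertices p : 'I_n.+1 -> R^2,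
   the i-th segment running from p i to p (i + 1) with cyclic indices (ordS is
   the cyclic successor and ord_pred the cyclic predecessor). The angle theta i
   sits at p i, between the segments i - 1 and i. *)
Section Curves.
Variables (R : realType) (n : nat).
Implicit Types (p q : 'I_n.+1 -> plane R) (F : 'I_n.+1 -> segment R).
Implicit Types (phi : plane R -> R) (alpha : R) (i : 'I_n.+1).

Definition side p i : segment R := (p i, p (ordS i)).

Definition closed_polygonal p : Prop :=
  (forall i, (side p i).1 != (side p i).2) /\
  (forall i, ~ seg_parallel (side p (ord_pred i)) (side p i)).

Definition normal p i : plane R := seg_normal (side p i).

Definition len p i : R := seg_length (side p i).

(* Both normals at p i are inner normals of the cone with apex p i spanned by
   the segments i - 1 and i. *)
Definition inner_normals p i : bool :=
  let u := p (ord_pred i) - p i in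
  let v := p (ordS i) - p i in
  [&& 0 <= dot (normal p (ord_pred i)) u, 0 <= dot (normal p (ord_pred i)) v,
      0 <= dot (normal p i) u & 0 <= dot (normal p i) v].

Definition theta p i : R :=
  let a := acos (dot (unit_vec (p (ord_pred i) - p i))
                     (unit_vec (p (ordS i) - p i))) in
  if inner_normals p i then a else 2 * pi - a.

Definition transition p i : R :=
  if (pi < theta p i < 2 * pi) && (pi < theta p (ordS i) < 2 * pi) then 1
  else if (0 < theta p i < pi) && (0 < theta p (ordS i) < pi) then -1
  else 0.

(* F i is the facet of the Wulff shape associated with the segment i; as a set
   it is determined by phi and the normal of that segment. *)
Definition admissible phi F p : Prop :=
  [/\ closed_polygonal p,
      forall i, is_facet (wulff phi) (F i) (normal p i) &
      forall i, common_vertex (F (ord_pred i)) (F i)].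

Definition delta phi F p i : R :=
  seg_length (F i) ^+ 2 * dual_norm phi (normal p i).

Definition energy phi alpha F p : R :=
  \sum_i dual_norm phi (normal p i) *
    (len p i +
     alpha * (transition p i ^+ 2 * seg_length (F i) ^+ 2 / len p i)).

Definition parallel p q : Prop :=
  forall i, [/\ (side q i).1 != (side q i).2,
    seg_parallel (side p i) (side q i) & normal q i = normal p i].

Definition stationarity_term phi alpha F p i : R :=
  let w j := transition p j ^+ 2 * delta phi F p j / len p j ^+ 2 in
  transition p i * seg_length (F i) +
  alpha * (w (ord_pred i) / sin (theta p i) +
           w i * (cot (theta p i) + cot (theta p (ordS i))) +
           w (ordS i) / sin (theta p (ordS i))).

Definition stationary phi alpha F p : Prop :=
  admissible phi F p /\ forall i, stationarity_term phi alpha F p i = 0.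

Definition Delta1 p : R :=
  2^-1 * min_ord (fun i => len p i /
    (`|sin (theta p i)|^-1 + `|cot (theta p i) + cot (theta p (ordS i))| +
     `|sin (theta p (ordS i))|^-1)).

End Curves.

(* Main.v *)
(* The proof takes beta = 1. Let t_i be the unit tangents and h_i the component
   of H(S_i^0, S_i) along the normal. The lengths of the sides of a parallel
   curve are affine in h, so the energy, a sum of terms A L + B / L with
   B >= 0, is a convex function of h on the set where all lengths are positive.
   Its partial derivative in h_i is the i-th stationarity term: for the surface
   part, summation by parts against the common vertices x_i of F_(i-1) and F_i
   gives sum_i phi^o(nu_i) L_i = sum_i c_i |F_i| <p_(i+1), nu_i>, because
   x_(i+1) - x_i = c_i |F_i| t_i. Hence a stationary curve is a minimizer, and
   convexity at the curve Gamma gives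
   0 <= E(Gamma) - E(Gamma^0) <= sum_i h_i T_i(Gamma). The restriction |h_i| <
   Delta_1 keeps the length of S_i above half that of S_i^0, so the maximum on
   the right-hand side is bounded below unless all c_i vanish, in which case
   the energy is identically 0. *)
Require Import Defs.
From HB Require Import structures.
From mathcomp Require Import all_boot all_order all_algebra.
From mathcomp Require Import all_classical all_reals all_analysis.
From mathcomp Require Import ring lra.

Import Order.TTheory GRing.Theory Num.Theory.

Set Implicit Arguments.
Unset Strict Implicit.
Unset Printing Implicit Defensive.

Local Open Scope ring_scope.

(** * Dot products, rotation and determinants in the plane *)

Section PlaneGeometry.
Variable R : realType.
Implicit Types (u v w t x y : plane R) (a b : R).

Lemma dotE u v : dot u v = u 0 0 * v 0 0 + u 0 1 * v 0 1.
Proof.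
by rewrite /dot big_ord_recl big_ord1; congr (_ + u _ _ * v _ _); apply: val_inj.
Qed.

Lemma rot90E0 u : rot90 u 0 0 = - u 0 1. Proof. by rewrite mxE. Qed.
Lemma rot90E1 u : rot90 u 0 1 = u 0 0. Proof. by rewrite mxE. Qed.

Lemma plane_eqP u v : u 0 0 = v 0 0 -> u 0 1 = v 0 1 -> u = v.
Proof.
move=> e0 e1; apply/rowP => -[[|[|//]] hk].
- by rewrite (_ : Ordinal hk = 0)//; apply: val_inj.
- by rewrite (_ : Ordinal hk = 1)//; apply: val_inj.
Qed.

Definition coordE := (dotE, rot90E0, rot90E1, mxE).

Lemma dot_ge0 u : 0 <= dot u u.
Proof. by rewrite dotE; nra. Qed.

Lemma dot_gt0 u : u != 0 -> 0 < dot u u.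
Proof.
move=> u0; rewrite lt_neqAle dot_ge0 andbT eq_sym; apply: contra_neq u0.
rewrite dotE => h; have := sqr_ge0 (u 0 0); have := sqr_ge0 (u 0 1).
by rewrite !expr2 => h1 h2; apply: plane_eqP; rewrite mxE;
  apply/eqP; rewrite -sqrf_eq0 expr2; apply/eqP; lra.
Qed.

Lemma sqr_enorm u : enorm u ^+ 2 = dot u u.
Proof. by rewrite /enorm sqr_sqrtr// dot_ge0. Qed.

Lemma enorm_gt0 u : u != 0 -> 0 < enorm u.
Proof. by move=> u0; rewrite sqrtr_gt0 dot_gt0. Qed.

Lemma dotZl a u v : dot (a *: u) v = a * dot u v.
Proof. by rewrite !coordE; ring. Qed.

Lemma dotZr a u v : dot u (a *: v) = a * dot u v.
Proof. by rewrite !coordE; ring. Qed.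

Lemma unit_vec_unit u : u != 0 -> dot (unit_vec u) (unit_vec u) = 1.
Proof.
by move=> u0; rewrite /unit_vec dotZl dotZr -sqr_enorm; field; rewrite gt_eqF ?enorm_gt0.
Qed.

Lemma unit_vecK u : u != 0 -> enorm u *: unit_vec u = u.
Proof. by move=> u0; rewrite /unit_vec scalerA divff ?scale1r// gt_eqF// enorm_gt0. Qed.

Lemma rot90_inj : injective (@rot90 R).
Proof.
move=> u v /rowP e; have := e 0; have := e 1; rewrite !mxE /= => e1 e0.
by apply: plane_eqP => //; apply: oppr_inj.
Qed.

Lemma dot_rot90_self t : dot t (rot90 t) = 0.
Proof. by rewrite !coordE; ring. Qed.

Lemma dot_rot90 u v : dot (rot90 u) (rot90 v) = dot u v.
Proof. by rewrite !coordE; ring. Qed.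

Lemma dotC u v : dot u v = dot v u.
Proof. by rewrite !dotE; ring. Qed.

Lemma dotBl u v w : dot (u - v) w = dot u w - dot v w.
Proof. by rewrite !coordE; ring. Qed.

Lemma det2C u v : det2 u v = - det2 v u.
Proof. by rewrite /det2; ring. Qed.

Lemma dot_sqr_det2_sqr u v : dot u v ^+ 2 + det2 u v ^+ 2 = dot u u * dot v v.
Proof. by rewrite !dotE /det2; ring. Qed.

(** Expansion of [rot90 u] in the orthonormal frame [t], [rot90 t]. It relates a normal direction to
    the frame of a neighbouring side, both for vertex displacements and for facets. *)
Lemma dot_rot90_decomp u v t : dot t t = 1 ->
  dot v (rot90 u) = dot u t * dot v (rot90 t) + det2 u t * dot v t.
Proof.
by move=> tt; rewrite -[LHS]mul1r -tt /det2 !coordE; ring.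
Qed.

Lemma plane_basis u v t : dot t t = 1 ->
  dot u t = dot v t -> dot u (rot90 t) = dot v (rot90 t) -> u = v.
Proof.
rewrite !coordE => tt h1 h2; apply: plane_eqP; rewrite -[LHS]mul1r -[RHS]mul1r -tt.
- transitivity (t 0 0 * (u 0 0 * t 0 0 + u 0 1 * t 0 1)
    - t 0 1 * (u 0 0 * - t 0 1 + u 0 1 * t 0 0)); first by ring.
  by rewrite h1 h2; ring.
- transitivity (t 0 1 * (u 0 0 * t 0 0 + u 0 1 * t 0 1)
    + t 0 0 * (u 0 0 * - t 0 1 + u 0 1 * t 0 0)); first by ring.
  by rewrite h1 h2; ring.
Qed.

Lemma dot_rot90_le_enorm w t : dot t t = 1 -> `|dot w (rot90 t)| <= enorm w.
Proof.
move=> tt; rewrite -(ler_pXn2r (n:=2)) ?nnegrE ?sqrtr_ge0//.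
rewrite sqr_enorm real_normK ?num_real//.
have := dot_sqr_det2_sqr w (rot90 t); rewrite dot_rot90 tt mulr1 => <-.
by rewrite lerDl sqr_ge0.
Qed.

End PlaneGeometry.

(** * Turning angles of closed polygonal curves *)

Section Angles.
Variables (R : realType) (n : nat).
Implicit Types (p q : 'I_n.+1 -> plane R) (i : 'I_n.+1) (t u v : plane R).

Lemma dot_rot90_det2 u v : dot (rot90 u) v = det2 u v.
Proof. by rewrite /det2 !coordE; ring. Qed.

Lemma unit_vecZ (a : R) t : 0 < a -> dot t t = 1 -> unit_vec (a *: t) = t.
Proof.
move=> a0 tt; rewrite /unit_vec /enorm dotZl dotZr tt mulr1 -expr2 sqrtr_sqr gtr0_norm//.
by rewrite scalerA mulVf ?scale1r// gt_eqF.
Qed.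

Definition tangent p i : plane R := unit_vec (dir (side p i)).
(** Sine and, below, cosine of the signed exterior angle at [p i]. Since [theta] is pi minus that
    angle, the sines agree and the cosines are opposite. *)
Definition turn_sin p i : R := det2 (tangent p (ord_pred i)) (tangent p i).
Definition turn_cos p i : R := dot (tangent p (ord_pred i)) (tangent p i).

Section ClosedPolygonal.
Variable p : 'I_n.+1 -> plane R.
Hypothesis cp : closed_polygonal p.

Lemma dir_side_neq0 i : dir (side p i) != 0.
Proof. by rewrite subr_eq0 eq_sym; case: cp => + _; apply. Qed.

Lemma tangent_unit i : dot (tangent p i) (tangent p i) = 1.
Proof. exact/unit_vec_unit/dir_side_neq0. Qed.

Lemma len_gt0 i : 0 < len p i.
Proof. exact/enorm_gt0/dir_side_neq0. Qed.

Lemma next_vertexE i : p (ordS i) - p i = len p i *: tangent p i.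
Proof. by rewrite unit_vecK// dir_side_neq0. Qed.

Lemma prev_vertexE i : p (ord_pred i) - p i =
  len p (ord_pred i) *: - tangent p (ord_pred i).
Proof. by rewrite scalerN -next_vertexE ord_predK opprB. Qed.

Lemma turn_sin_neq0 i : turn_sin p i != 0.
Proof.
apply/eqP => s0; case: cp => _ /(_ i); apply; rewrite /seg_parallel.
have -> : dir (side p (ord_pred i)) = len p (ord_pred i) *: tangent p (ord_pred i).
  by rewrite -next_vertexE.
have -> : dir (side p i) = len p i *: tangent p i by rewrite -next_vertexE.
transitivity (len p (ord_pred i) * len p i * turn_sin p i).
  by rewrite /turn_sin /det2 !mxE; ring.
by rewrite s0 mulr0.
Qed.

Lemma turn_sqr i : turn_cos p i ^+ 2 + turn_sin p i ^+ 2 = 1.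
Proof. by rewrite dot_sqr_det2_sqr !tangent_unit mulr1. Qed.

(** Each normal is orthogonal to its own side, so two of the four products vanish; the other two are
    positive multiples of [turn_sin p i], which is nonzero. *)
Lemma inner_normalsE i : inner_normals p i = (0 < turn_sin p i).
Proof.
rewrite /inner_normals next_vertexE prev_vertexE.
rewrite /normal /seg_normal -!/(tangent _ _) !(dotZr (len p _)) !dot_rot90_det2.
rewrite !pmulr_rge0 ?len_gt0//.
have det2v t : det2 t t = 0 by rewrite /det2; ring.
have det2N t u : det2 t (- u) = det2 u t by rewrite /det2 !mxE; ring.
rewrite !det2N !det2v lexx.
rewrite -/(turn_sin p i).
by rewrite lt0r turn_sin_neq0 ?andbT ?andbb.
Qed.

Lemma thetaE i : theta p i = if 0 < turn_sin p i then acos (- turn_cos p i)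
  else 2 * pi - acos (- turn_cos p i).
Proof.
rewrite /theta inner_normalsE next_vertexE prev_vertexE.
rewrite !unit_vecZ ?len_gt0 ?tangent_unit//; last first.
  by rewrite -[RHS](tangent_unit (ord_pred i)) !coordE; ring.
have -> // : dot (- tangent p (ord_pred i)) (tangent p i) = - turn_cos p i.
by rewrite /turn_cos !coordE; ring.
Qed.

Let cos_itv i : -1 < - turn_cos p i < 1.
Proof.
have := turn_sqr i; have : 0 < turn_sin p i ^+ 2.
  by rewrite exprn_even_gt0//= turn_sin_neq0.
by rewrite !expr2 => *; apply/andP; split; nra.
Qed.

Let cos_acosN i : cos (acos (- turn_cos p i)) = - turn_cos p i.
Proof. by rewrite acosK// in_itv /=; case/andP: (cos_itv i) => /ltW -> /ltW ->. Qed.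

Let sin_acosN i : sin (acos (- turn_cos p i)) = `|turn_sin p i|.
Proof.
rewrite sin_acos; last by case/andP: (cos_itv i) => /ltW -> /ltW ->.
by rewrite sqrrN -(turn_sqr i) addrC addKr sqrtr_sqr.
Qed.

Let acosN_itv i : 0 < acos (- turn_cos p i) < pi.
Proof.
case/andP: (cos_itv i) => h1 h2.
by rewrite acos_gt0 ?acos_ltpi// ?h1 ?h2 ?(ltW h1) ?(ltW h2).
Qed.

Lemma sin_theta i : sin (theta p i) = turn_sin p i.
Proof.
rewrite thetaE; case: ltP => s0; first by rewrite sin_acosN gtr0_norm.
by rewrite mulr_natl sinB sin2pi cos2pi mul0r mul1r sub0r sin_acosN ler0_norm ?opprK.
Qed.

Lemma cos_theta i : cos (theta p i) = - turn_cos p i.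
Proof.
rewrite thetaE; case: ltP => s0; first by rewrite cos_acosN.
by rewrite mulr_natl cosB sin2pi cos2pi mul0r mul1r addr0 cos_acosN.
Qed.

Lemma convex_angleE i : (0 < theta p i < pi) = (0 < turn_sin p i).
Proof.
have := acosN_itv i; rewrite thetaE; case: (ltP 0 (turn_sin p i)) => // _.
by set A := acos _ => /andP[? ?]; apply/negbTE/negP => /andP[? ?]; lra.
Qed.

Lemma reflex_angleE i : (pi < theta p i < 2 * pi) = (turn_sin p i < 0).
Proof.
have := acosN_itv i; rewrite thetaE; set A := acos _.
have := turn_sin_neq0 i; case: (ltgtP 0 (turn_sin p i)) => // s0 _ /andP[? ?].
- by apply/negbTE/negP => /andP[? ?]; lra.
- by apply/andP; split; lra.
Qed.

Lemma transitionE i : transition p i =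
  if (turn_sin p i < 0) && (turn_sin p (ordS i) < 0) then 1
  else if (0 < turn_sin p i) && (0 < turn_sin p (ordS i)) then -1 else 0.
Proof. by rewrite /transition !reflex_angleE !convex_angleE. Qed.

End ClosedPolygonal.

(** * Parallel curves and the variation of their side lengths *)

Section ParallelCurves.
Variables p q : 'I_n.+1 -> plane R.
Hypotheses (cp : closed_polygonal p) (cq : closed_polygonal q) (pq : parallel p q).

Lemma parallel_tangent i : tangent q i = tangent p i.
Proof. by case: (pq i) => _ _ /rot90_inj. Qed.

Lemma parallel_turn_sin i : turn_sin q i = turn_sin p i.
Proof. by rewrite /turn_sin !parallel_tangent. Qed.

Lemma parallel_transition i : transition q i = transition p i.
Proof. by rewrite !transitionE// !parallel_turn_sin. Qed.

Lemma parallel_normal i : normal q i = normal p i.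
Proof. by case: (pq i). Qed.

Variable h : 'I_n.+1 -> R.
Hypothesis h_start : forall i, dot (q i - p i) (normal p i) = h i.
Hypothesis h_end : forall i, dot (q (ordS i) - p (ordS i)) (normal p i) = h i.

Lemma len_variation i : len p i - len q i =
  h (ord_pred i) / sin (theta p i) +
  h i * (cot (theta p i) + cot (theta p (ordS i))) +
  h (ordS i) / sin (theta p (ordS i)).
Proof.
set t := tangent p i; have tt : dot t t = 1 := tangent_unit cp i.
have lenE : len q i - len p i = dot (q (ordS i) - p (ordS i)) t - dot (q i - p i) t.
  transitivity (dot (len q i *: tangent q i - len p i *: tangent p i) t).
    by rewrite parallel_tangent dotBl !(dotZl (len _ _)) tt !mulr1.
  by rewrite -!next_vertexE// !dotBl; ring.
(* The vertex [p i] also ends side [i - 1]; the offset of that side is written in the frame of side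
   [i]. *)
have pred_eq : h (ord_pred i) =
    turn_cos p i * h i + turn_sin p i * dot (q i - p i) t.
  rewrite -(h_end (ord_pred i)) ord_predK -(h_start i).
  exact: dot_rot90_decomp.
have succ_eq : h (ordS i) =
    turn_cos p (ordS i) * h i
    - turn_sin p (ordS i) * dot (q (ordS i) - p (ordS i)) t.
  rewrite -(h_start (ordS i)) -(h_end i) /turn_cos /turn_sin ordSK.
  rewrite [dot (tangent p i) _]dotC det2C mulNr opprK.
  exact: dot_rot90_decomp.
have si := turn_sin_neq0 cp i; have sj := turn_sin_neq0 cp (ordS i).
rewrite -opprB lenE /cot !sin_theta// !cos_theta// pred_eq succ_eq.
by field; rewrite si sj.
Qed.

End ParallelCurves.
End Angles.

(** * Facets of the Wulff shape and the dual norm *)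

Section Facets.
Variable R : realType.
Implicit Types (W : set (plane R)) (G : segment R) (t u v x y z : plane R).

Definition endpoint G x : Prop := x = G.1 \/ x = G.2.

Lemma facet_endpoint W G v x : is_facet W G v -> endpoint G x ->
  W x /\ forall y, W y -> dot y v <= dot x v.
Proof.
case=> _ _ e ex.
suff: [set x | W x /\ forall y, W y -> dot y v <= dot x v]%classic x by [].
rewrite -e; case: ex => ->.
- by exists 0; rewrite ?lexx ?ler01// scale0r addr0.
- by exists 1; rewrite ?lexx ?ler01// scale1r addrC subrK.
Qed.

Lemma dual_norm_facet (phi : plane R -> R) G v x :
  is_facet (wulff phi) G v -> endpoint G x -> dual_norm phi v = dot x v.
Proof.
move=> fG ex; have [Wx xmax] := facet_endpoint fG ex.
have ub : ubound [set dot v y | y in wulff phi]%classic (dot x v).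
  by move=> _ [y Wy <-]; rewrite dotC; exact: xmax.
apply/le_anti/andP; split.
- by apply: ge_sup => //; exists (dot v x); exists x.
- by apply: ub_le_sup; [exists (dot x v) | exists x => //; rewrite dotC].
Qed.

(** The upper bound on [phi] puts [C^-1 *: v] in the Wulff shape, and its product with the unit
    vector [v] is [C^-1]. *)
Lemma dual_norm_gt0 (phi : plane R -> R) G v :
  anisotropy phi -> is_facet (wulff phi) G v -> 0 < dual_norm phi v.
Proof.
case=> _ _ _ [c [C [c0 cC phiC]]] fG; have C0 := lt_le_trans c0 cC.
have eG : endpoint G G.1 by left.
rewrite (dual_norm_facet fG eG); case: (facet_endpoint fG eG) => _.
have vv : dot v v = 1 by case: fG => _ v1 _; rewrite -sqr_enorm v1 expr1n.
move=> /(_ (C^-1 *: v)) h; apply: lt_le_trans (h _).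
  by rewrite dotZl vv mulr1 invr_gt0.
rewrite /wulff /=; case/andP: (phiC (C^-1 *: v)) => _ /le_trans; apply.
rewrite /enorm dotZl dotZr vv mulr1 -expr2 sqrtr_sqr gtr0_norm ?invr_gt0//.
by rewrite divff// gt_eqF.
Qed.

(* An endpoint of a facet that also lies on a neighbouring facet maximizes the
   neighbouring normal, whose component along the facet has the sign of the
   turning angle: this tells which of the two endpoints it is. *)
Lemma facet_common_endpoint W G G' t t' x z : dot t t = 1 ->
  is_facet W G (rot90 t) -> is_facet W G' (rot90 t') ->
  endpoint G x -> endpoint G' x -> endpoint G z ->
  det2 t' t * dot z t <= det2 t' t * dot x t.
Proof.
move=> tt fG fG' ex ex' ez.
have [Wx xmax] := facet_endpoint fG ex; have [Wz zmax] := facet_endpoint fG ez.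
have [_ /(_ _ Wz)] := facet_endpoint fG' ex'.
rewrite !(dot_rot90_decomp t' _ tt).
have -> : dot z (rot90 t) = dot x (rot90 t).
  by apply/le_anti; rewrite xmax ?zmax.
by rewrite lerD2l.
Qed.

(** The sign of each turn selects an endpoint of [G]. Equal signs select opposite endpoints, so
    [y - x] runs along the whole facet, forwards for two right turns and backwards for two left
    turns; different signs select the same endpoint. *)
Lemma facet_traversal W G G' G'' t t' t'' x y : dot t t = 1 ->
  is_facet W G (rot90 t) -> is_facet W G' (rot90 t') -> is_facet W G'' (rot90 t'') ->
  endpoint G x -> endpoint G' x -> endpoint G y -> endpoint G'' y ->
  det2 t' t != 0 -> det2 t t'' != 0 ->
  y - x = ((if (det2 t' t < 0) && (det2 t t'' < 0) then 1
            else if (0 < det2 t' t) && (0 < det2 t t'') then -1 else 0)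
           * seg_length G) *: t.
Proof.
move=> tt fG fG' fG'' ex ex' ey ey'' s0 s1.
have e1 : endpoint G G.1 by left.
have e2 : endpoint G G.2 by right.
have normal_eq z1 z2 : endpoint G z1 -> endpoint G z2 ->
    dot z1 (rot90 t) = dot z2 (rot90 t).
  move=> h1 h2; have [W1 m1] := facet_endpoint fG h1.
  by have [W2 m2] := facet_endpoint fG h2; apply/le_anti; rewrite m1 ?m2.
have dirG : G.2 - G.1 = (dot G.2 t - dot G.1 t) *: t.
  apply: (plane_basis tt); rewrite dotBl dotZl ?tt ?mulr1//.
  by rewrite dot_rot90_self mulr0 (normal_eq _ _ e2 e1) subrr.
have lenG : seg_length G = `|dot G.2 t - dot G.1 t|.
  by rewrite /seg_length /dir dirG /enorm dotZl dotZr tt mulr1 -expr2 sqrtr_sqr.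
apply: (plane_basis tt); last first.
  by rewrite dotBl dotZl dot_rot90_self mulr0 (normal_eq _ _ ey ex) subrr.
rewrite dotBl dotZl tt mulr1 lenG.
have xm z (ez : endpoint G z) := facet_common_endpoint tt fG fG' ex ex' ez.
have ym z (ez : endpoint G z) := facet_common_endpoint tt fG fG'' ey ey'' ez.
have {xm} := (xm _ e1, xm _ e2); have {ym} := (ym _ e1, ym _ e2).
rewrite (det2C t'' t) !mulNr !lerN2 => -[].
(* Once both signs are fixed, [x] and [y] each maximize or minimize the component along [t] over the
   two endpoints. *)
case: (ltgtP 0 (det2 t' t)) s0 => // s0 _;
case: (ltgtP 0 (det2 t t'')) s1 => // s1 _ /=;
rewrite ?(ler_pM2l s0) ?(ler_pM2l s1) ?(ler_nM2l s0) ?(ler_nM2l s1) => y1 y2 [x1 x2];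
case: ex ey x1 x2 y1 y2 => -> [] -> x1 x2 y1 y2;
case: (ger0P (dot G.2 t - dot G.1 t)) => ?; lra.
Qed.

End Facets.

(** * The energy as a convex function of the offsets *)

Section Energy.
Variables (R : realType) (n : nat) (phi : plane R -> R) (alpha : R).
Variable F : 'I_n.+1 -> segment R.
Implicit Types (p q : 'I_n.+1 -> plane R) (h : 'I_n.+1 -> R) (i : 'I_n.+1).

(** The coefficients on the right depend on [p] alone, so the surface energy is linear in the
    vertices of [q]. *)
Lemma surface_energyE p q : admissible phi F p -> closed_polygonal q -> parallel p q ->
  \sum_i dual_norm phi (normal q i) * len q i =
  \sum_i transition p i * seg_length (F i) * dot (q (ordS i)) (normal p i).
Proof.
case=> cp fF cvF cq pq.
have /choice[x xP] : forall i, exists y : plane R,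
    endpoint (F (ord_pred i)) y /\ endpoint (F i) y.
  move=> i; case: (cvF i) => e.
  - by exists (F i).1; split; [left|left].
  - by exists (F i).2; split; [left|right].
  - by exists (F i).1; split; [right|left].
  - by exists (F i).2; split; [right|right].
have step i : x (ordS i) - x i = (transition p i * seg_length (F i)) *: tangent p i.
  have [ex' ex] := xP i; have [ey ey''] := xP (ordS i); rewrite ordSK in ey.
  rewrite transitionE//.
  have := turn_sin_neq0 cp (ordS i); rewrite /turn_sin ordSK => s1.
  exact: (facet_traversal (tangent_unit cp i) (fF _) (fF _) (fF _)
    ex ex' ey ey'' (turn_sin_neq0 cp i)).
(* The vertex [x i] attains the dual norm of normal [i], and that normal times the length is the
   rotated edge vector. *)
transitivity (\sum_i (dot (x i) (rot90 (q (ordS i))) - dot (x i) (rot90 (q i)))).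
  apply: eq_bigr => i _.
  rewrite (parallel_normal pq) (dual_norm_facet (fF i) (xP i).2) -(parallel_normal pq).
  transitivity (dot (x i) (rot90 (len q i *: tangent q i))).
    by rewrite /normal /seg_normal -/(tangent q i) !coordE; ring.
  by rewrite -next_vertexE// !coordE; ring.
(* Summation by parts: the cyclic shift moves the difference from [q] to [x]. *)
rewrite sumrB [X in _ - X](reindex _ (onW_bij _ (@ordS_bij n.+1))) /= -sumrB.
apply: eq_bigr => i _.
transitivity (- dot (x (ordS i) - x i) (rot90 (q (ordS i)))).
  by rewrite dotBl; ring.
by rewrite step dotZl /normal /seg_normal -/(tangent p i) !coordE; ring.
Qed.

Let weight p i := transition p i ^+ 2 * delta phi F p i.

Lemma parallel_refl p : closed_polygonal p -> parallel p p.
Proof.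
move=> cp i; split=> //; first by case: cp => + _; apply.
by rewrite /seg_parallel /det2 mulrC subrr.
Qed.

Lemma parallel_sym p q : closed_polygonal p -> parallel p q -> parallel q p.
Proof.
move=> cp pq i; case: (pq i) => _ par ->; split=> //.
- by case: cp => + _; apply.
- by rewrite /seg_parallel det2C par oppr0.
Qed.

Lemma energyE p q : admissible phi F p -> closed_polygonal q -> parallel p q ->
  energy phi alpha F q =
  \sum_i transition p i * seg_length (F i) * dot (q (ordS i)) (normal p i) +
  alpha * \sum_i weight p i / len q i.
Proof.
move=> ap cq pq; have cp : closed_polygonal p by case: ap.
rewrite -(surface_energyE ap cq pq) mulr_sumr -big_split.
apply: eq_bigr => i _ /=.
rewrite (parallel_normal pq) (parallel_transition cp cq pq) /weight /delta.
by ring.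
Qed.

Lemma delta_gt0 p i : anisotropy phi -> admissible phi F p -> 0 < delta phi F p i.
Proof.
move=> aphi [_ fF _]; rewrite mulr_gt0 ?(dual_norm_gt0 aphi (fF i))//.
have [F12 _ _] := fF i.
by rewrite exprn_gt0// enorm_gt0// subr_eq0 eq_sym.
Qed.

Lemma weight_ge0 p i : anisotropy phi -> admissible phi F p -> 0 <= weight p i.
Proof. by move=> aphi ap; rewrite mulr_ge0 ?sqr_ge0// ltW ?delta_gt0. Qed.

Section Offsets.
Variables (p q : 'I_n.+1 -> plane R) (h : 'I_n.+1 -> R).
Hypotheses (cp : closed_polygonal p) (cq : closed_polygonal q) (pq : parallel p q).
Hypothesis h_start : forall i, dot (q i - p i) (normal p i) = h i.
Hypothesis h_end : forall i, dot (q (ordS i) - p (ordS i)) (normal p i) = h i.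

(** The matrix giving the length variations from the offsets is symmetric, so it can be moved from
    the weights to [h]; the two cyclic reindexings carry this out. *)
Lemma sum_stationarity_term :
  \sum_i h i * stationarity_term phi alpha F p i =
  \sum_i transition p i * seg_length (F i) * h i +
  alpha * \sum_i weight p i / len p i ^+ 2 * (len p i - len q i).
Proof.
pose w i := weight p i / len p i ^+ 2; pose s i := sin (theta p i).
pose c i := cot (theta p i) + cot (theta p (ordS i)).
transitivity (\sum_i (transition p i * seg_length (F i) * h i +
    alpha * (h i * w (ord_pred i) / s i +
    (h i * (w i * c i) + h i * w (ordS i) / s (ordS i))))).
  by apply: eq_bigr => i _; rewrite /stationarity_term -!/(weight p _) -!/(w _);
    rewrite -/(c _) -!/(s _); ring.
rewrite big_split /= -mulr_sumr; congr (_ + _ * _).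
rewrite big_split /= (reindex _ (onW_bij _ (@ordS_bij n.+1))) /=.
rewrite big_split /= [X in _ + (_ + X)](reindex _ (onW_bij _ (@ord_pred_bij n.+1))) /=.
rewrite -!big_split; apply: eq_bigr => i _ /=.
rewrite ordSK ord_predK (len_variation cp cq pq h_start h_end).
by rewrite -/(w i) -!/(s _) -/(c i); ring.
Qed.

(* The energy is a convex function of the offsets whose partial derivatives are
   the stationarity terms. *)
Lemma energy_tangent_ineq : anisotropy phi -> 0 < alpha -> admissible phi F p ->
  energy phi alpha F p + \sum_i h i * stationarity_term phi alpha F p i
  <= energy phi alpha F q.
Proof.
move=> aphi a0 ap.
have pp := parallel_refl cp.
rewrite (energyE ap cp pp) (energyE ap cq pq) sum_stationarity_term addrACA.
(* The surface part is affine, so its linearization is exact. What remains is the tangent line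
   inequality for the convex function 1/L, where the gap is an explicit square over a positive
   number. *)
rewrite -big_split -mulrDr -big_split /=; apply: lerD.
  by apply: ler_sum => i _; rewrite -h_end dotBl -mulrDr addrC subrK.
rewrite ler_pM2l//; apply: ler_sum => i _.
have Lp := len_gt0 cp i; have Lq := len_gt0 cq i.
rewrite -mulrA -mulrDr; apply: ler_wpM2l; first exact: weight_ge0.
rewrite -subr_ge0.
have -> : (len q i)^-1 - ((len p i)^-1 + (len p i ^+ 2)^-1 * (len p i - len q i))
    = (len p i - len q i) ^+ 2 / (len p i ^+ 2 * len q i).
  by field; rewrite !gt_eqF.
by rewrite divr_ge0 ?sqr_ge0// mulr_ge0 ?exprn_ge0 ?ltW.
Qed.

(** The denominator in [Delta1] is the sum of the absolute values of the coefficients in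
    [len_variation]. Offsets up to [Delta1 p] thus change a length by at most half of it. *)
Lemma half_len_le : (forall i, `|h i| <= Delta1 p) ->
  forall i, 2^-1 * len p i <= len q i.
Proof.
move=> hD i; set d := Delta1 p.
have Lp := len_gt0 cp i.
have s0 := turn_sin_neq0 cp i; have s1 := turn_sin_neq0 cp (ordS i).
set D := `|sin (theta p i)|^-1 + `|cot (theta p i) + cot (theta p (ordS i))| +
     `|sin (theta p (ordS i))|^-1.
have D0 : 0 < D.
  by rewrite /D !sin_theta// addr_gt0 ?invr_gt0 ?normr_gt0//
    ltr_wpDr ?invr_gt0 ?normr_gt0.
have dD : d * D <= 2^-1 * len p i.
  rewrite -ler_pdivlMr// -mulrA ler_wpM2l ?invr_ge0//.
  exact: (bigmin_le _ i).
have := len_variation cp cq pq h_start h_end i => lv.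
suff : `|len p i - len q i| <= d * D.
  move=> /(le_trans (ler_norm _)) hl; have := le_trans hl dD; lra.
rewrite lv; apply: (le_trans (ler_normD _ _)).
rewrite /D [leRHS]mulrDr lerD//; last first.
  by rewrite normrM normfV ler_wpM2r ?invr_ge0.
apply: (le_trans (ler_normD _ _)).
by rewrite [leRHS]mulrDr lerD// normrM ?normfV ler_wpM2r ?invr_ge0.
Qed.

End Offsets.

(** Moving along the line of [S] leaves the normal component unchanged, so both endpoints are
    displaced by the same normal amount. *)
Lemma offset_dot_normal (S T : segment R) v : is_offset S T v ->
  dot (T.1 - S.1) (seg_normal S) = dot v (seg_normal S) /\
  dot (T.2 - S.2) (seg_normal S) = dot v (seg_normal S).
Proof.
case=> _ e.
have onT z : seg_line T z -> exists t, z = S.1 + t *: dir S + v.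
  by rewrite e => -[_ [t ->] <-]; exists t.
have h t : dot (S.1 + t *: dir S + v - S.1) (seg_normal S) = dot v (seg_normal S) /\
    dot (S.1 + t *: dir S + v - S.2) (seg_normal S) = dot v (seg_normal S).
  by rewrite /seg_normal /unit_vec /dir !coordE; split; ring.
have [t1 ->] : exists t, T.1 = S.1 + t *: dir S + v.
  by apply: onT; exists 0; rewrite scale0r addr0.
have [t2 ->] : exists t, T.2 = S.1 + t *: dir S + v.
  by apply: onT; exists 1; rewrite scale1r addrC subrK.
by split; [case: (h t1) | case: (h t2)].
Qed.

End Energy.

(** * The inequality near a stationary curve *)

Lemma max_ord_ge (R : realType) (n : nat) (f : 'I_n.+1 -> R) i : f i <= max_ord f.
Proof. exact: le_bigmax. Qed.

Theorem proposition6p6 (R : realType) (phi : plane R -> R) (alpha : R)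
    (n : nat) (F : 'I_n.+1 -> segment R) (p0 : 'I_n.+1 -> plane R) :
  crystalline phi ->
  0 < alpha ->
  stationary phi alpha F p0 ->
  exists C beta : R, [/\ 0 < C, 0 < beta &
    forall (p H : 'I_n.+1 -> plane R),
      admissible phi F p ->
      parallel p0 p ->
      (forall i, is_offset (side p0 i) (side p i) (H i)) ->
      max_ord (fun i => enorm (H i)) < Delta1 p0 ->
      `|energy phi alpha F p - energy phi alpha F p0| `^ beta <=
        C * (alpha * max_ord (fun i =>
               transition p i ^+ 2 * delta phi F p i * len p i)) `^ beta *
        \sum_i `|stationarity_term phi alpha F p i| ].
Proof.
move=> [aphi _] a0 [ap0 st0]; have cp0 : closed_polygonal p0 by case: ap0.
pose d := Delta1 p0; pose a i := transition p0 i ^+ 2 * delta phi F p0 i.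
pose m := max_ord (fun i => a i * len p0 i).
have a_ge0 i : 0 <= a i by rewrite mulr_ge0 ?sqr_ge0// ltW ?delta_gt0.
have am i : a i * len p0 i <= m := max_ord_ge _ i.
(* m = 0 exactly when all transition numbers vanish. *)
exists (if (0 < m) && (0 < d) then 2 * d / (alpha * m) else 1), 1; split=> //.
  by case: ifP => // /andP[? ?]; apply: divr_gt0; apply: mulr_gt0.
move=> p H ap pp0 offH Hd; have cp : closed_polygonal p by case: ap.
pose h i := dot (H i) (normal p0 i).
have h_start i : dot (p i - p0 i) (normal p0 i) = h i.
  exact: (offset_dot_normal (offH i)).1.
have h_end i : dot (p (ordS i) - p0 (ordS i)) (normal p0 i) = h i.
  exact: (offset_dot_normal (offH i)).2.
have hd i : `|h i| <= d.
  apply: le_trans (ltW Hd); apply: le_trans (max_ord_ge (fun i => enorm (H i)) i).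
  exact/dot_rot90_le_enorm/tangent_unit.
(* A norm lies strictly below [d]. This is known only once a curve is given, which is why the
   constant chosen beforehand tests [0 < d]. *)
have d0 : 0 < d.
  apply: le_lt_trans Hd; apply: le_trans (max_ord_ge (fun i => enorm (H i)) ord0).
  exact: sqrtr_ge0.
have p0p := parallel_sym cp0 pp0.
have lower : energy phi alpha F p0 <= energy phi alpha F p.
  have := energy_tangent_ineq cp0 cp pp0 h_start h_end aphi a0 ap0.
  by rewrite big1 ?addr0// => i _; rewrite st0 mulr0.
(* The tangent inequality is now based at [p], with [p0] as the competitor and offsets [- h i]. *)
have upper : energy phi alpha F p - energy phi alpha F p0 <=
    \sum_i h i * stationarity_term phi alpha F p i.
  have opp_h_start i : dot (p0 i - p i) (normal p i) = - h i.
    by rewrite (parallel_normal pp0) -h_start -opprB -scaleN1r dotZl mulN1r.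
  have opp_h_end i : dot (p0 (ordS i) - p (ordS i)) (normal p i) = - h i.
    by rewrite (parallel_normal pp0) -h_end -opprB -scaleN1r dotZl mulN1r.
  have := energy_tangent_ineq cp cp0 p0p opp_h_start opp_h_end aphi a0 ap.
  under eq_bigr do rewrite mulNr.
  by rewrite sumrN; lra.
have eqp i : transition p i ^+ 2 * delta phi F p i = a i.
  by rewrite /a /delta (parallel_transition cp0 cp pp0) (parallel_normal pp0).
set M := max_ord _.
have M_ge i : a i * len p i <= M by rewrite -eqp; exact: max_ord_ge.
have M0 : 0 <= M.
  by apply: le_trans (M_ge ord0); rewrite mulr_ge0// ltW ?len_gt0.
rewrite !powRr1 ?mulr_ge0 ?normr_ge0 ?(ltW a0)// ger0_norm ?subr_ge0// d0 andbT.
case: ltP => [m_gt0|m_le0].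
  (* Lengths at least half the original ones give this bound. The constant [2 * d / (alpha * m)]
     times [alpha * M] is then at least [d], which bounds every offset. *)
  have mM : m <= 2 * M.
    have lb i : a i * len p0 i <= 2 * M.
      apply: le_trans (_ : 2 * (a i * len p i) <= _); last by rewrite ler_pM2l.
      have := ler_wpM2l (a_ge0 i) (half_len_le cp0 cp pp0 h_start h_end hd i); lra.
    by apply/bigmax_leP; split.
  apply: (le_trans upper).
  apply: (@le_trans _ _ (d * \sum_i `|stationarity_term phi alpha F p i|)).
    rewrite mulr_sumr; apply: ler_sum => i _; apply: le_trans (ler_norm _) _.
    by rewrite normrM ler_wpM2r.
  apply: ler_wpM2r; first exact: sumr_ge0.
  have -> : 2 * d / (alpha * m) * (alpha * M) = d * ((2 * M) / m).
    by field; rewrite !gt_eqF.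
  by rewrite ler_peMr ?(ltW d0)// ler_pdivlMr// mul1r.
have tr0 i : transition p0 i = 0.
  have : a i = 0.
    apply/le_anti; rewrite a_ge0 andbT -(pmulr_lle0 _ (len_gt0 cp0 i)).
    exact: le_trans (am i) m_le0.
  by move/eqP; rewrite mulf_eq0 (gt_eqF (delta_gt0 _ aphi ap0)) orbF sqrf_eq0 => /eqP.
(* Both the linear surface part and the curvature part carry the transition numbers as factors. *)
have E0 q : closed_polygonal q -> parallel p0 q -> energy phi alpha F q = 0.
  move=> cq pq; rewrite (energyE _ ap0 cq pq) !big1 ?mulr0 ?addr0// => i _.
    by rewrite tr0 expr0n /= !mul0r.
  by rewrite tr0 !mul0r.
rewrite !E0 ?subrr//; last exact: parallel_refl.
by rewrite !mulr_ge0 ?sumr_ge0// ltW.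
Qed.
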